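(* For the message spaces $\mathcal{M}_i$ described in the context, the dimensionality of agent $i$'s message is $$M_i=1+4L_i+N(i)L+|I_i|+2\sum_{j\in I_i}L_j+2|\mathcal{C}_i|.$$ The average size (over agents) of the set $I_i$ is $1$, and the average size of $\mathcal{C}_i$ is $\frac{\sum_{l\in\mathcal{L}}K^l}{N}$. Consequently, with $\bar N=\mathbb{E}_{i\in\mathcal{N}}(N(i))$ and $\bar L=\mathbb{E}_{i\in\mathcal{N}}(L_i)$, the average size of the whole network's message is $$\mathbb{E}\Big(\sum_{i\in\mathcal{N}}M_i\Big)=N\Big(2+4\bar L+\bar N L+2\,\frac{\sum_{i\in\mathcal{N}}L_i}{N}+2\,\frac{\sum_{l\in\mathcal{L}}K^l}{N}\Big),$$ which grows linearly with the number of agents in the network, $N$.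
   Context: $\mathcal{N}=\{1,\dots,N\}$ (agents), $\mathcal{K}=\{1,\dots,K\}$ (groups), $\mathcal{L}=\{1,\dots,L\}$ (links). Each agent $i$ belongs to exactly one group $k(i)$; $\mathcal{G}_k=\{i:k(i)=k\}$. Agent $i$ uses the links $\mathcal{L}_i\subset\mathcal{L}$, $L_i=|\mathcal{L}_i|$. For each link $l$: $\mathcal{N}^l=\{i:l\in\mathcal{L}_i\}$, $\mathcal{G}_k^l=\mathcal{N}^l\cap\mathcal{G}_k$, $\mathcal{K}^l=\{k:\mathcal{G}_k^l\neq\emptyset\}$, $K^l=|\mathcal{K}^l|\ge 2$. The message graph $\mathcal{GR}=(\mathcal{N},\mathcal{E})$ is an undirected tree on $\mathcal{N}$; $\mathcal{N}(i)$ is the set of neighbors of $i$ and $N(i)=|\mathcal{N}(i)|$. For each agent $i$, the function $\Phi$ arbitrarily chooses one agent $\Phi(i)\in\mathcal{N}(i)$, and $I_i=\{h\in\mathcal{N}(i):\Phi(h)=i\}$. Assumption on the message graph: for each $l\in\mathcal{L}$ the subgraph of $\mathcal{GR}$ on $\mathcal{N}^l$ is connected, and for each $l\in\mathcal{L}$, $k\in\mathcal{K}^l$ there is at least one node of $\mathcal{G}_k^l$ that is connected (by an edge) to all other nodes of $\mathcal{G}_k^l$; such a node is denoted $c(k,l)$. $\mathcal{C}_i$ is the set of links $l$ for which $c(k(i),l)=i$. Agent $i$'s message is $m_i=(y_i,\underline{y_i},n_i,q_i,p_i,w_i,z_i,a_i)\in\mathcal{M}_i$ where: $y_i\in\mathbb{R}_+$;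 $\underline{y_i}=(\underline{y_i}^l)_{l\in\mathcal{L}_i}\in\mathbb{R}_+^{L_i}$; $n_i=(n_i^{j,l})_{j\in\mathcal{N}(i),l\in\mathcal{L}}$ with entries in $\mathbb{R}_+$; $q_i=(q_i^j)_{j\in I_i}$ with entries in $\mathbb{R}_+$; $p_i=({}^1p_i,{}^2p_i)$ with ${}^1p_i=({}^1p_i^l)_{l\in\mathcal{L}_i}$, ${}^2p_i=({}^2p_i^{j,l})_{j\in I_i,l\in\mathcal{L}_j}$, entries in $\mathbb{R}_+$; $w_i=(w_i^l)_{l\in\mathcal{L}_i}$ with entries in $\mathbb{R}_+$; $z_i=({}^1z_i,{}^2z_i)$ with ${}^1z_i=({}^1z_i^l)_{l\in\mathcal{C}_i}$, ${}^2z_i=({}^2z_i^l)_{l\in\mathcal{C}_i}$, entries in $\mathbb{R}_+$; $a_i=({}^1a_i,{}^2a_i)$ with ${}^1a_i=({}^1a_i^l)_{l\in\mathcal{L}_i}$, ${}^2a_i=({}^2a_i^{j,l})_{j\in I_i,l\in\mathcal{L}_j}$, entries in $(0,\infty)$. The dimensionality of a message is its number of real components. $\mathbb{E}_{i\in\mathcal{N}}(\cdot)$ denotes the average over agents $i\in\mathcal{N}$, and $\mathbb{E}(\sum_{i\in\mathcal{N}}M_i)$ denotes the average size of the whole network's message, computed from the averages over agents of $N(i)$, $L_i$, $|I_i|$ and $|\mathcal{C}_i|$. *)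

(* Defs.v *)
From HB Require Import structures.
From mathcomp Require Import all_boot all_order all_algebra.
From mathcomp Require Import reals.

Set Implicit Arguments.
Unset Strict Implicit.
Unset Printing Implicit Defensive.

Import Order.TTheory GRing.Theory Num.Theory.
Local Open Scope ring_scope.

(* N agents, K groups and L links.  [hub k l] is the agent c(k,l); it is
   meaningful only when some agent of group k uses link l, and its value is
   junk otherwise. *)
Record network (N K L : nat) := Network {
  group_of : 'I_N -> 'I_K;
  links : 'I_N -> {set 'I_L};
  edge : rel 'I_N;
  Phi : 'I_N -> 'I_N;
  hub : 'I_K -> 'I_L -> 'I_N
}.

Section Network.
Variables (N K L : nat) (net : network N K L).
Implicit Types (i j : 'I_N) (k : 'I_K) (l : 'I_L).

Definition users l : {set 'I_N} := [set i | l \in links net i].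

Definition members k : {set 'I_N} := [set i | group_of net i == k].

Definition group_users k l : {set 'I_N} := users l :&: members k.

Definition link_groups l : {set 'I_K} := [set k | group_users k l != set0].

Definition nbrs i : {set 'I_N} := [set j | edge net i j].

(* The set I_i. *)
Definition Iset i : {set 'I_N} := [set h in nbrs i | Phi net h == i].

(* The set C_i; the first condition says that c(k(i),l) is defined. *)
Definition Cset i : {set 'I_L} :=
  [set l | (group_of net i \in link_groups l)
           && (hub net (group_of net i) l == i)].

Definition connected_on (A : {set 'I_N}) : Prop :=
  forall i j, i \in A -> j \in A ->
    connect [rel x y | [&& x \in A, y \in A & edge net x y]] i j.

(* In a symmetric relation every edge is a [ucycle] of size 2, so proper cycles
   are those of size at least 3. *)
Record is_tree : Prop := IsTree {
  tree_nonempty : (0 < N)%N;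
  tree_sym : symmetric (edge net);
  tree_irr : irreflexive (edge net);
  tree_connected : connected_on [set: 'I_N];
  tree_acyclic : forall s : seq 'I_N, ucycle (edge net) s -> (size s <= 2)%N
}.

Record admissible : Prop := Admissible {
  adm_groups : forall l, (2 <= #|link_groups l|)%N;
  adm_tree : is_tree;
  adm_Phi : forall i, Phi net i \in nbrs i;
  adm_link_connected : forall l, connected_on (users l);
  adm_hub : forall l k, k \in link_groups l ->
    hub net k l \in group_users k l
    /\ forall j, j \in group_users k l -> j != hub net k l ->
         edge net (hub net k l) j
}.

(* The positions of the real components of a message
   (y, (y^l), (n^{j,l}), (q^j), (1p, 2p), w, (1z, 2z), (1a, 2a)) of agent i. *)
Inductive msg_coord i : Type :=
  | Cy
  | Cyl of {l | l \in links net i}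
  | Cn of {j | j \in nbrs i} & 'I_L
  | Cq of {j | j \in Iset i}
  | Cp1 of {l | l \in links net i}
  | Cp2 of {j : {j | j \in Iset i} & {l | l \in links net (val j)}}
  | Cw of {l | l \in links net i}
  | Cz1 of {l | l \in Cset i}
  | Cz2 of {l | l \in Cset i}
  | Ca1 of {l | l \in links net i}
  | Ca2 of {j : {j | j \in Iset i} & {l | l \in links net (val j)}}.

Section CoordFinite.
Variable i : 'I_N.
Let Li := {l | l \in links net i}.
Let Ii := {j | j \in Iset i}.
Let Ci := {l | l \in Cset i}.
Let LIi := {j : Ii & {l | l \in links net (val j)}}.

Definition coord_code : Type :=
  unit + (Li + ({j | j \in nbrs i} * 'I_L + (Ii + (Li + (LIi
  + (Li + (Ci + (Ci + (Li + LIi))))))))).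

Definition encode_coord (c : msg_coord i) : coord_code :=
  match c with
  | Cy => inl tt
  | Cyl l => inr (inl l)
  | Cn j l => inr (inr (inl (j, l)))
  | Cq j => inr (inr (inr (inl j)))
  | Cp1 l => inr (inr (inr (inr (inl l))))
  | Cp2 u => inr (inr (inr (inr (inr (inl u)))))
  | Cw l => inr (inr (inr (inr (inr (inr (inl l))))))
  | Cz1 l => inr (inr (inr (inr (inr (inr (inr (inl l)))))))
  | Cz2 l => inr (inr (inr (inr (inr (inr (inr (inr (inl l))))))))
  | Ca1 l => inr (inr (inr (inr (inr (inr (inr (inr (inr (inl l)))))))))
  | Ca2 u => inr (inr (inr (inr (inr (inr (inr (inr (inr (inr u)))))))))
  end.

Definition decode_coord (s : coord_code) : msg_coord i :=
  match s with
  | inl _ => Cy i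
  | inr (inl l) => Cyl l
  | inr (inr (inl (j, l))) => Cn j l
  | inr (inr (inr (inl j))) => Cq j
  | inr (inr (inr (inr (inl l)))) => Cp1 l
  | inr (inr (inr (inr (inr (inl u))))) => Cp2 u
  | inr (inr (inr (inr (inr (inr (inl l)))))) => Cw l
  | inr (inr (inr (inr (inr (inr (inr (inl l))))))) => Cz1 l
  | inr (inr (inr (inr (inr (inr (inr (inr (inl l)))))))) => Cz2 l
  | inr (inr (inr (inr (inr (inr (inr (inr (inr (inl l))))))))) => Ca1 l
  | inr (inr (inr (inr (inr (inr (inr (inr (inr (inr u))))))))) => Ca2 u
  end.

Lemma encode_coordK : cancel encode_coord decode_coord.
Proof. by case. Qed.

End CoordFinite.

HB.instance Definition _ i :=
  Finite.copy (msg_coord i) (can_type (@encode_coordK i)).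

Definition positive_coord i (c : msg_coord i) : bool :=
  match c with Ca1 _ | Ca2 _ => true | _ => false end.

(* The entries of a_i range over the positive reals, all the other components
   over the nonnegative reals. *)
Definition message_space (R : realType) i : {pred {ffun msg_coord i -> R}} :=
  fun m => [forall c, if positive_coord c then 0 < m c else 0 <= m c].

End Network.

(* The number of real components of the elements of a set of messages. *)
Definition dimensionality (R : realType) (I : finType)
  (S : {pred {ffun I -> R}}) : nat := #|I|.

(* The number M_i. *)
Definition message_dim (R : realType) N K L (net : network N K L)
  (i : 'I_N) : nat := dimensionality (@message_space N K L net R i).

Definition average (R : realType) N (f : 'I_N -> nat) : R :=
  (\sum_(i < N) (f i)%:R) / N%:R.

(* E(\sum_i M_i): by linearity, every agent contributes the average message
   size. *)
Definition mean_network_size (R : realType) N K L (net : network N K L) : R :=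
  \sum_(i < N) average R (message_dim R net).

Lemma mean_network_sizeE (R : realType) N K L (net : network N K L) :
  (0 < N)%N ->
  mean_network_size R net = (\sum_(i < N) message_dim R net i)%:R.
Proof.
move=> N_gt0; rewrite /mean_network_size sumr_const card_ord /average.
by rewrite -(mulr_natr (_ / _)) divfK ?pnatr_eq0 -?lt0n // natr_sum.
Qed.

(* Main.v *)
(** The Phi-fibres I_i partition the agents, and the hubs send the pairs (k, l)
    with k \in K^l injectively onto the pairs (i, l) with l \in C_i; double
    counting gives the two averages and the formula.  For the linear bounds with
    constants depending on L only, a finite acyclic graph on A has degree sum at
    most 2 #|A|: an endpoint of a maximal path has degree at most 1, and it can
    be removed. *)

Require Import Defs.
From mathcomp Require Import all_boot all_order all_algebra.
From mathcomp Require Import reals.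
From mathcomp Require Import zify ring.

Import Order.TTheory GRing.Theory Num.Theory.
Local Open Scope ring_scope.

Section AcyclicDegreeSum.
Local Open Scope nat_scope.
Variables (T : finType) (e : rel T).
Hypothesis e_sym : symmetric e.
Hypothesis e_irr : irreflexive e.
Hypothesis e_acyclic : forall s : seq T, ucycle e s -> size s <= 2.

(** The path grows at its front [x]: as long as [x] has two neighbours in [A], one of them lies off
    the path, since otherwise a cycle would close up. Finiteness of [T] stops the growth. *)
Lemma acyclic_leaf_of_path (A : {set T}) x p :
  x \in A -> path e x p -> uniq (x :: p) ->
  exists2 z, z \in A & #|[set y in A | e z y]| <= 1.
Proof.
have [n] := ubnP (#|T| - size p); elim: n x p => // n IHn x p le_n xA xp Up.
have [small|big] := leqP #|[set y in A | e x y]| 1; first by exists x.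
(* The excluded vertex is the successor of [x] on the path, or [x] itself when [p] is empty; a set
   of at least two elements survives the removal of one. *)
have /set0Pn[y] : [set y in A | e x y] :\ head x p != set0.
  rewrite -card_gt0; have := cardsD1 (head x p) [set y in A | e x y].
  by case: (_ \in _) => /= E; lia.
rewrite !inE => /and3P[y_head yA exy].
have y_x : y != x by apply: contraTneq exy => ->; rewrite e_irr.
have [yp|yNp] := boolP (y \in p).
  case/splitPr: yp xp Up y_head => p1 p2 xp Up y_head.
  have : ucycle e (x :: rcons p1 y).
    apply/andP; split.
      move: xp; rewrite /= cat_path /= rcons_path rcons_path last_rcons.
      by rewrite (e_sym y) exy => /and3P[-> -> _].
    by move: Up; rewrite -cat_rcons -cat_cons cat_uniq => /andP[].
  (* The cycle has at least 3 vertices unless [p1] is empty, and then [y] would be the excluded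
     successor of [x]. *)
  move/e_acyclic; rewrite /= size_rcons.
  by case: p1 {xp Up} y_head => //=; rewrite eqxx.
have Uyp : uniq (y :: x :: p) by rewrite cons_uniq inE negb_or y_x yNp.
apply: (IHn y (x :: p)) => //=; last by rewrite (e_sym y) exy.
have := max_card (mem (y :: x :: p)); rewrite (card_uniqP Uyp) /= => le_card.
rewrite -ltnS; apply: leq_trans le_n; rewrite ltnS ltn_sub2l //.
exact: leq_trans le_card.
Qed.

(** Deleting a leaf [x] loses its own degree and, by symmetry, the same amount from its neighbours,
    hence at most 2. *)
Lemma acyclic_degree_sum (A : {set T}) :
  \sum_(x in A) #|[set y in A | e x y]| <= 2 * #|A|.
Proof.
have [n] := ubnP #|A|; elim: n A => // n IHn A le_n.
have [->|/set0Pn[x0 x0A]] := eqVneq A set0; first by rewrite big_set0.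
have [x xA deg_x] := @acyclic_leaf_of_path A x0 [::] x0A isT isT.
have cardA := cardsD1 x A; rewrite xA in cardA.
have {}IHn := IHn (A :\ x) ltac:(lia).
rewrite (big_setD1 x) //=.
have degD z : z \in A :\ x ->
    #|[set y in A | e z y]| = e x z + #|[set y in A :\ x | e z y]|.
  move=> _; rewrite (cardsD1 x) inE xA e_sym /=; congr (_ + _).
  by apply: eq_card => y; rewrite !inE andbA.
rewrite (eq_bigr _ degD) big_split /=.
have : \sum_(z in A :\ x) e x z <= #|[set y in A | e x y]|.
  rewrite -big_mkcondr -sum1_card /=.
  rewrite [leqRHS](eq_bigl (fun z => (z \in A :\ x) && e x z)) ?big_mkcondr //=.
  move=> z; rewrite !inE; case: eqP => //= ->; by rewrite e_irr andbF.
lia.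
Qed.

End AcyclicDegreeSum.

Section NetworkCounting.
Local Open Scope nat_scope.
Variables (N K L : nat) (net : network N K L).

Lemma card_msg_coord (i : 'I_N) :
  #|{: msg_coord net i}| =
    1 + 4 * #|links net i| + #|nbrs net i| * L + #|Iset net i|
    + 2 * (\sum_(j in Iset net i) #|links net j|) + 2 * #|Cset net i|.
Proof.
(* With [encode_coordK] this makes the encoding a bijection, so the count can be read off the nested
   sum type. *)
have decodeK : cancel (@decode_coord N K L net i) (@encode_coord N K L net i).
  by repeat case=> //.
rewrite (bij_eq_card (Bijective (@encode_coordK N K L net i) decodeK)).
have sigE M (A : {set 'I_M}) : #|{: {x | x \in A}}| = #|A|.
  by rewrite card_sig; apply: eq_card.
rewrite !card_sum !card_prod card_unit card_ord !sigE !card_tagged.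
rewrite sumnE big_map big_enum /=.
rewrite (eq_bigr _ (fun j _ => sigE _ (links net (val j)))).
rewrite -(big_sub (mem (Iset net i)) (fun j => #|links net j|)).
ring.
Qed.

Hypothesis adm : admissible net.

(** Each [j] lies in the single fibre over [Phi net j]; the neighbour condition in [Iset] follows
    from [adm_Phi] and the symmetry of edges. *)
Lemma sum_Iset (f : 'I_N -> nat) :
  \sum_(i < N) \sum_(j in Iset net i) f j = \sum_(j < N) f j.
Proof.
have [_ [_ e_sym _ _ _] PhiP _ _] := adm.
rewrite [RHS](partition_big (Phi net) xpredT) //=; apply: eq_bigr => i _.
apply: eq_bigl => j; rewrite !inE andbC.
case: eqP => //= <-; by rewrite e_sym; have := PhiP j; rewrite inE.
Qed.

Lemma sum_card_Iset : \sum_(i < N) #|Iset net i| = N.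
Proof.
under eq_bigr do rewrite -sum1_card.
by rewrite sum_Iset sum1_card card_ord.
Qed.

(** A hub belongs to the group it serves, so for fixed [l] the group can be recovered from its
    hub. *)
Lemma card_link_groups_hub (l : 'I_L) :
  #|link_groups net l| = #|[set i | l \in Cset net i]|.
Proof.
have [_ _ _ _ hubP] := adm.
have hub_group k : k \in link_groups net l -> group_of net (hub net k l) = k.
  by move=> kl; have [] := hubP l k kl; rewrite !inE => /andP[_ /eqP].
rewrite -(@card_in_imset _ _ (hub net ^~ l)) => [|k1 k2 /hub_group h1 /hub_group h2 E].
  apply: eq_card => i; rewrite [RHS]inE [RHS]inE.
  apply/imsetP/andP => [[k kl ->]|[kl /eqP E]].
    by rewrite hub_group.
  by exists (group_of net i).
by rewrite -h1 -h2 E.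
Qed.

Lemma sum_card_Cset :
  \sum_(i < N) #|Cset net i| = \sum_(l < L) #|link_groups net l|.
Proof.
under eq_bigr do rewrite -sum1_card big_mkcond.
rewrite exchange_big; apply: eq_bigr => l _ /=.
rewrite card_link_groups_hub -sum1_card [RHS]big_mkcond /=.
by apply: eq_bigr => i _; rewrite [i \in _]inE.
Qed.

Lemma sum_card_nbrs : \sum_(i < N) #|nbrs net i| <= 2 * N.
Proof.
have [_ [_ e_sym e_irr _ e_acyc] _ _ _] := adm.
have := @acyclic_degree_sum _ _ e_sym e_irr e_acyc [set: 'I_N].
rewrite cardsT card_ord; apply: leq_trans; rewrite big_mkcond /=.
apply: eq_leq; rewrite [RHS]big_mkcond /=; apply: eq_bigr => i _; rewrite inE.
by apply: eq_card => j; rewrite !inE.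
Qed.

Lemma card_links_le (i : 'I_N) : #|links net i| <= L.
Proof. by rewrite -[leqRHS](card_ord L) max_card. Qed.

Lemma card_Cset_le (i : 'I_N) : #|Cset net i| <= L.
Proof. by rewrite -[leqRHS](card_ord L) max_card. Qed.

(** The 6 is 4 from the components indexed by an agent's own links plus 2 from those indexed by the
    links of [Iset], resummed by [sum_Iset]. *)
Lemma sum_message_dim (R : realType) :
  \sum_(i < N) message_dim R net i =
    2 * N + 6 * (\sum_(i < N) #|links net i|) + (\sum_(i < N) #|nbrs net i|) * L
    + 2 * (\sum_(l < L) #|link_groups net l|).
Proof.
rewrite (eq_bigr _ (fun i _ => card_msg_coord i)) !big_split /=.
rewrite -big_distrl /= !big1_eq sum_Iset sum_card_Iset sum_card_Cset.
rewrite sum1_card card_ord; ring.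
Qed.

Lemma sum_message_dim_bounds (R : realType) :
  N <= \sum_(i < N) message_dim R net i <= (2 + 10 * L) * N.
Proof.
(* Going back to the sets [Cset], each of size at most [L], keeps the bound free of [K]. The 10 is
   then 6 from links, 2 from neighbours and 2 from [Cset]. *)
rewrite sum_message_dim -sum_card_Cset.
have sum_le (f : 'I_N -> nat) : (forall i, f i <= L) -> \sum_(i < N) f i <= N * L.
  move=> fL; rewrite -[X in X * L](card_ord N) -sum_nat_const; exact: leq_sum.
have := sum_le _ card_links_le; have := sum_le _ card_Cset_le.
have := sum_card_nbrs; nia.
Qed.

End NetworkCounting.

Theorem mainTheorem3 (R : realType) :
  (forall (N K L : nat) (net : network N K L), admissible net ->
     [/\ forall i : 'I_N,
           message_dim R net i =
             (1 + 4 * #|links net i| + #|nbrs net i| * L + #|Iset net i|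
              + 2 * (\sum_(j in Iset net i) #|links net j|)
              + 2 * #|Cset net i|)%N,
         average R (fun i : 'I_N => #|Iset net i|) = 1,
         average R (fun i : 'I_N => #|Cset net i|)
           = (\sum_(l < L) #|link_groups net l|%:R) / N%:R
       & let Nbar := average R (fun i : 'I_N => #|nbrs net i|) in
         let Lbar := average R (fun i : 'I_N => #|links net i|) in
         mean_network_size R net =
           N%:R * (2 + 4 * Lbar + Nbar * L%:R
                   + 2 * ((\sum_(i < N) #|links net i|%:R) / N%:R)
                   + 2 * ((\sum_(l < L) #|link_groups net l|%:R) / N%:R))])
  /\
  (forall L : nat, exists a b : R,
     [/\ 0 < a, 0 < b &
         forall (N K : nat) (net : network N K L), admissible net ->
           a * N%:R <= mean_network_size R net <= b * N%:R]).
Proof.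
split=> [N K L net adm|L].
  have N_gt0 : (0 < N)%N by case: adm => _ [].
  have N_neq0 : N%:R != 0 :> R by rewrite pnatr_eq0 -lt0n.
  split=> [i| | |Nbar Lbar]; first exact: card_msg_coord.
  - by rewrite /average -natr_sum sum_card_Iset ?divff.
  - by rewrite /average -natr_sum sum_card_Cset ?natr_sum.
  rewrite mean_network_sizeE // sum_message_dim // /Nbar /Lbar /average.
  rewrite !natrD !natrM !natr_sum; field.
  by rewrite N_neq0.
(* Both constants are chosen before [N], [K] and the network, which is what makes the growth linear
   in [N]. *)
exists 1, (2 + 10 * L)%:R; split=> [||N K net adm]; rewrite ?ltr0n //.
have N_gt0 : (0 < N)%N by case: adm => _ [].
rewrite mean_network_sizeE // mul1r -natrM !ler_nat.
exact: sum_message_dim_bounds.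
Qed.
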